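(* Let $R:L\to L$ be a Rota-Baxter operator on a compatible Lie Yamaguti algebra $(L,[\cdot,\cdot]_1,[\cdot,\cdot,\cdot]_1,[\cdot,\cdot]_2,[\cdot,\cdot,\cdot]_2)$. For $i\in\{1,2\}$ define linear maps $\star_i:\otimes^2L\to L$ and $\{\cdot,\cdot,\cdot\}_i:\otimes^3L\to L$ by $$x\star_iy:=[Rx,y]_i,\qquad \{x,y,z\}_i:=[x,Ry,Rz]_i\qquad (x,y,z\in L).$$ Then $(L,\star_1,\{\cdot,\cdot,\cdot\}_1,\star_2,\{\cdot,\cdot,\cdot\}_2)$ is a compatible pre-Lie Yamaguti algebra.
   Context: All vector spaces are over a field $\mathbb{K}$ of characteristic $0$. A Lie Yamaguti algebra is a vector space $L$ with a bilinear bracket $[\cdot,\cdot]:\wedge^2L\to L$ and a trilinear bracket $[\cdot,\cdot,\cdot]:\wedge^2L\otimes L\to L$ such that for all $x,y,z,w,t\in L$: (LY1) $[[x,y],z]+[[y,z],x]+[[z,x],y]+[x,y,z]+[y,z,x]+[z,x,y]=0$; (LY2) $[[x,y],z,w]+[[y,z],x,w]+[[z,x],y,w]=0$; (LY3) $[x,y,[z,w]]=[[x,y,z],w]+[z,[x,y,w]]$; (LY4) $[x,y,[z,w,t]]=[[x,y,z],w,t]+[z,[x,y,w],t]+[z,w,[x,y,t]]$. A compatible Lie Yamaguti algebra is a 5-tuple $(L,[\cdot,\cdot]_1,[\cdot,\cdot,\cdot]_1,[\cdot,\cdot]_2,[\cdot,\cdot,\cdot]_2)$ such that $(L,[\cdot,\cdot]_i,[\cdot,\cdot,\cdot]_i)$,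 $i=1,2$, are Lie Yamaguti algebras and, for all $x,y,z,t,a,b\in L$ (c.p. = the remaining cyclic permutations in $x,y,z$): (CY1) $[[x,y]_1,z]_2+c.p.+[[x,y]_2,z]_1+c.p.=0$; (CY2) $[[x,y]_1,z,t]_2+[[y,z]_1,x,t]_2+[[z,x]_1,y,t]_2+[[x,y]_2,z,t]_1+[[y,z]_2,x,t]_1+[[z,x]_2,y,t]_1=0$; (CY3) $[a,b,[x,y,z]_1]_2+[a,b,[x,y,z]_2]_1=[[a,b,x]_1,y,z]_2+[x,[a,b,y]_1,z]_2+[x,y,[a,b,z]_1]_2+[[a,b,x]_2,y,z]_1+[x,[a,b,y]_2,z]_1+[x,y,[a,b,z]_2]_1$; (CY4) $[a,b,[x,y]_1]_2+[a,b,[x,y]_2]_1=[[a,b,x]_1,y]_2+[x,[a,b,y]_1]_2+[[a,b,x]_2,y]_1+[x,[a,b,y]_2]_1$. A Rota-Baxter operator (of weight $0$) on a Lie Yamaguti algebra $(L,[\cdot,\cdot],[\cdot,\cdot,\cdot])$ is a linear map $R:L\to L$ such that for all $x,y,z\in L$: $[Rx,Ry]=R([x,Ry]+[Rx,y])$ and $[Rx,Ry,Rz]=R([Rx,Ry,z]+[Rx,y,Rz]+[x,Ry,Rz])$. A Rota-Baxter operator on a compatible Lie Yamaguti algebra is a linear map $R:L\to L$ that is a Rota-Baxter operator on both $(L,[\cdot,\cdot]_1,[\cdot,\cdot,\cdot]_1)$ and $(L,[\cdot,\cdot]_2,[\cdot,\cdot,\cdot]_2)$. A pre-Lie Yamaguti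 algebra $(L,\star,\{\cdot,\cdot,\cdot\})$ is a vector space $L$ with a bilinear operation $\star:\otimes^2L\to L$ and a trilinear operation $\{\cdot,\cdot,\cdot\}:\otimes^3L\to L$ such that, with $[x,y]_C:=x\star y-y\star x$, $(x,y,z):=(x\star y)\star z-x\star(y\star z)$ and $\{x,y,z\}_D:=\{z,y,x\}-\{z,x,y\}+(y,x,z)-(x,y,z)$, for all $x,y,z,w,t\in L$: (1) $\{z,[x,y]_C,w\}-\{y\star z,x,w\}+\{x\star z,y,w\}=0$; (2) $\{x,y,[z,w]_C\}=z\star\{x,y,w\}-w\star\{x,y,z\}$; (3) $\{\{x,y,z\},w,t\}-\{\{x,y,w\},z,t\}-\{x,y,\{z,w,t\}_D\}-\{x,y,\{z,w,t\}\}+\{x,y,\{w,z,t\}\}+\{z,w,\{x,y,t\}\}_D=0$; (4) $\{z,\{x,y,w\}_D,t\}+\{z,\{x,y,w\},t\}-\{z,\{y,x,w\},t\}+\{z,w,\{x,y,t\}_D\}+\{z,w,\{x,y,t\}\}-\{z,w,\{y,x,t\}\}=\{x,y,\{z,w,t\}\}_D-\{\{x,y,z\}_D,w,t\}$; (5) $\{x,y,z\}_D\star w+\{x,y,z\}\star w-\{y,x,z\}\star w=\{x,y,z\star w\}_D-z\star\{x,y,w\}_D$. A compatible pre-Lie Yamaguti algebra is a 5-tuple $(L,\star_1,\{\cdot,\cdot,\cdot\}_1,\star_2,\{\cdot,\cdot,\cdot\}_2)$ such that $(L,\star_i,\{\cdot,\cdot,\cdot\}_i)$, $i=1,2$, are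 pre-Lie Yamaguti algebras and, with $[x,y]_{i,c}=x\star_iy-y\star_ix$, $(x,y,z)_i=(x\star_iy)\star_iz-x\star_i(y\star_iz)$, $\{x,y,z\}_{i,D}=\{z,y,x\}_i-\{z,x,y\}_i+(y,x,z)_i-(x,y,z)_i$, and $\sum$ denoting the sum over $(i,j)\in\{(1,2),(2,1)\}$, for all $x,y,z,w,t\in L$: (CPLY1) $\sum(\{z,[x,y]_{i,c},w\}_j-\{y\star_iz,x,w\}_j+\{x\star_iz,y,w\}_j)=0$; (CPLY2) $\{x,y,[z,w]_{2,c}\}_1+\{x,y,[z,w]_{1,c}\}_2=z\star_1\{x,y,w\}_2+z\star_2\{x,y,w\}_1-w\star_1\{x,y,z\}_2-w\star_2\{x,y,z\}_1$; (CPLY3) $\sum(\{\{x,y,z\}_i,w,t\}_j-\{\{x,y,w\}_i,z,t\}_j-\{x,y,\{z,w,t\}_{i,D}\}_j-\{x,y,\{z,w,t\}_i\}_j+\{x,y,\{w,z,t\}_i\}_j+\{z,w,\{x,y,t\}_i\}_{j,D})=0$; (CPLY4) $\sum(\{z,\{x,y,w\}_{i,D},t\}_j+\{z,\{x,y,w\}_i,t\}_j-\{z,\{y,x,w\}_i,t\}_j+\{z,w,\{x,y,t\}_{i,D}\}_j+\{z,w,\{x,y,t\}_i\}_j-\{z,w,\{y,x,t\}_i\}_j)=\sum(\{x,y,\{z,w,t\}_i\}_{j,D}-\{\{x,y,z\}_{i,D},w,t\}_j)$; (CPLY5) $\sum(\{x,y,z\}_{i,D}\star_jw+\{x,y,z\}_i\star_jw-\{y,x,z\}_i\star_jw)=\sum(\{x,y,z\star_iw\}_{j,D}-z\star_i\{x,y,w\}_{j,D})$.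 *)

(* Defs.v *)
From HB Require Import structures.
From mathcomp Require Import all_boot all_order all_algebra.

Set Implicit Arguments.
Unset Strict Implicit.
Unset Printing Implicit Defensive.

Import GRing.Theory.
Local Open Scope ring_scope.

Section LieYamaguti.
Variables (K : fieldType) (L : lmodType K).

Definition is_bilinear (b : L -> L -> L) : Prop := bilinear_for *:%R *:%R b.

Definition is_trilinear (t : L -> L -> L -> L) : Prop :=
  (forall y z, linear (fun x => t x y z)) /\ (forall x, is_bilinear (t x)).

(* Maps on \wedge^2 L and on \wedge^2 L \otimes L are encoded as multilinear
   maps that vanish when the first two arguments coincide. *)
Record is_LieYamaguti (b : L -> L -> L) (t : L -> L -> L -> L) : Prop := {
  LY_bilinear : is_bilinear b;
  LY_trilinear : is_trilinear t;
  LY_alt2 : forall x, b x x = 0;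
  LY_alt3 : forall x z, t x x z = 0;
  LY1 : forall x y z,
    b (b x y) z + b (b y z) x + b (b z x) y
    + t x y z + t y z x + t z x y = 0;
  LY2 : forall x y z w,
    t (b x y) z w + t (b y z) x w + t (b z x) y w = 0;
  LY3 : forall x y z w,
    t x y (b z w) = b (t x y z) w + b z (t x y w);
  LY4 : forall x y z w u,
    t x y (t z w u) = t (t x y z) w u + t z (t x y w) u + t z w (t x y u)
}.

Record is_compatible_LieYamaguti
    (b1 : L -> L -> L) (t1 : L -> L -> L -> L)
    (b2 : L -> L -> L) (t2 : L -> L -> L -> L) : Prop := {
  CY_fst : is_LieYamaguti b1 t1;
  CY_snd : is_LieYamaguti b2 t2;
  CY1 : forall x y z,
    b2 (b1 x y) z + b2 (b1 y z) x + b2 (b1 z x) y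
    + (b1 (b2 x y) z + b1 (b2 y z) x + b1 (b2 z x) y) = 0;
  CY2 : forall x y z u,
    t2 (b1 x y) z u + t2 (b1 y z) x u + t2 (b1 z x) y u
    + t1 (b2 x y) z u + t1 (b2 y z) x u + t1 (b2 z x) y u = 0;
  CY3 : forall a b x y z,
    t2 a b (t1 x y z) + t1 a b (t2 x y z)
    = t2 (t1 a b x) y z + t2 x (t1 a b y) z + t2 x y (t1 a b z)
      + t1 (t2 a b x) y z + t1 x (t2 a b y) z + t1 x y (t2 a b z);
  CY4 : forall a b x y,
    t2 a b (b1 x y) + t1 a b (b2 x y)
    = b2 (t1 a b x) y + b2 x (t1 a b y)
      + b1 (t2 a b x) y + b1 x (t2 a b y)
}.

Definition is_RotaBaxter (b : L -> L -> L) (t : L -> L -> L -> L)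
    (R : {linear L -> L}) : Prop :=
  (forall x y, b (R x) (R y) = R (b x (R y) + b (R x) y)) /\
  (forall x y z,
     t (R x) (R y) (R z)
     = R (t (R x) (R y) z + t (R x) y (R z) + t x (R y) (R z))).

Definition is_compatible_RotaBaxter
    (b1 : L -> L -> L) (t1 : L -> L -> L -> L)
    (b2 : L -> L -> L) (t2 : L -> L -> L -> L)
    (R : {linear L -> L}) : Prop :=
  is_RotaBaxter b1 t1 R /\ is_RotaBaxter b2 t2 R.

Definition commutator (s : L -> L -> L) (x y : L) : L := s x y - s y x.

Definition associator (s : L -> L -> L) (x y z : L) : L :=
  s (s x y) z - s x (s y z).

Definition Dbracket (s : L -> L -> L) (p : L -> L -> L -> L) (x y z : L) : L :=
  p z y x - p z x y + associator s y x z - associator s x y z.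

Record is_preLieYamaguti (s : L -> L -> L) (p : L -> L -> L -> L) : Prop := {
  PLY_bilinear : is_bilinear s;
  PLY_trilinear : is_trilinear p;
  PLY1 : forall x y z w,
    p z (commutator s x y) w - p (s y z) x w + p (s x z) y w = 0;
  PLY2 : forall x y z w,
    p x y (commutator s z w) = s z (p x y w) - s w (p x y z);
  PLY3 : forall x y z w t,
    p (p x y z) w t - p (p x y w) z t - p x y (Dbracket s p z w t)
    - p x y (p z w t) + p x y (p w z t) + Dbracket s p z w (p x y t) = 0;
  PLY4 : forall x y z w t,
    p z (Dbracket s p x y w) t + p z (p x y w) t - p z (p y x w) t
    + p z w (Dbracket s p x y t) + p z w (p x y t) - p z w (p y x t)
    = Dbracket s p x y (p z w t) - p (Dbracket s p x y z) w t;
  PLY5 : forall x y z w,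
    s (Dbracket s p x y z) w + s (p x y z) w - s (p y x z) w
    = Dbracket s p x y (s z w) - s z (Dbracket s p x y w)
}.

(* The sum of E over (i, j) in {(1, 2), (2, 1)}; E receives the operations
   with index i, then the operations with index j. *)
Definition sum_ij
    (s1 : L -> L -> L) (p1 : L -> L -> L -> L)
    (s2 : L -> L -> L) (p2 : L -> L -> L -> L)
    (E : (L -> L -> L) -> (L -> L -> L -> L) ->
         (L -> L -> L) -> (L -> L -> L -> L) -> L) : L :=
  E s1 p1 s2 p2 + E s2 p2 s1 p1.

Record is_compatible_preLieYamaguti
    (s1 : L -> L -> L) (p1 : L -> L -> L -> L)
    (s2 : L -> L -> L) (p2 : L -> L -> L -> L) : Prop := {
  CPLY_fst : is_preLieYamaguti s1 p1;
  CPLY_snd : is_preLieYamaguti s2 p2;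
  CPLY1 : forall x y z w,
    sum_ij s1 p1 s2 p2 (fun si pi sj pj =>
      pj z (commutator si x y) w - pj (si y z) x w + pj (si x z) y w) = 0;
  CPLY2 : forall x y z w,
    p1 x y (commutator s2 z w) + p2 x y (commutator s1 z w)
    = s1 z (p2 x y w) + s2 z (p1 x y w) - s1 w (p2 x y z) - s2 w (p1 x y z);
  CPLY3 : forall x y z w t,
    sum_ij s1 p1 s2 p2 (fun si pi sj pj =>
      pj (pi x y z) w t - pj (pi x y w) z t - pj x y (Dbracket si pi z w t)
      - pj x y (pi z w t) + pj x y (pi w z t)
      + Dbracket sj pj z w (pi x y t)) = 0;
  CPLY4 : forall x y z w t,
    sum_ij s1 p1 s2 p2 (fun si pi sj pj =>
      pj z (Dbracket si pi x y w) t + pj z (pi x y w) t - pj z (pi y x w) t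
      + pj z w (Dbracket si pi x y t) + pj z w (pi x y t) - pj z w (pi y x t))
    = sum_ij s1 p1 s2 p2 (fun si pi sj pj =>
      Dbracket sj pj x y (pi z w t) - pj (Dbracket si pi x y z) w t);
  CPLY5 : forall x y z w,
    sum_ij s1 p1 s2 p2 (fun si pi sj pj =>
      sj (Dbracket si pi x y z) w + sj (pi x y z) w - sj (pi y x z) w)
    = sum_ij s1 p1 s2 p2 (fun si pi sj pj =>
      Dbracket sj pj x y (si z w) - si z (Dbracket sj pj x y w))
}.

End LieYamaguti.

(* Main.v *)
(* The binary Rota-Baxter identity and (LY1) give {x, y, z}_D = [Rx, Ry, z].
   With this, for fixed (i, j), each expression in (CPLY1)-(CPLY5) becomes a
   signed sum of terms of (LY2)-(LY4) if i = j, or one of the two halves of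
   (CY2)-(CY4) if i <> j. Computing with two structures that may coincide
   therefore treats the pre-Lie Yamaguti axioms and their compatibility at once. *)

Require Import Defs.
From HB Require Import structures.
From mathcomp Require Import all_boot all_order all_algebra.

Set Implicit Arguments.
Unset Strict Implicit.
Unset Printing Implicit Defensive.

Import GRing.Theory.
Local Open Scope ring_scope.

Section Multilinear.
Variables (K : fieldType) (L : lmodType K).
Implicit Types (b : L -> L -> L) (t : L -> L -> L -> L).

(** The pattern [x + y - z] is the one under [R] in [RB_ternary]; this splits a linear map along
    it. *)
Lemma linear_addsub (f : L -> L) : linear f ->
  forall x y z, f (x + y - z) = f x + f y - f z.
Proof.
move=> /zmod_morphism_linear fB x y z; rewrite fB; congr (_ - _).
by rewrite -{2}[x](addrK y) fB subrK.
Qed.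

Lemma bilinearBl b : is_bilinear b ->
  forall x x' y, b (x - x') y = b x y - b x' y.
Proof. by case=> + _ x x' y => /(_ y) /zmod_morphism_linear. Qed.

Lemma bilinearBr b : is_bilinear b ->
  forall x y y', b x (y - y') = b x y - b x y'.
Proof. by case=> _ + x => /(_ x) /zmod_morphism_linear. Qed.

Lemma bilinearNr b : is_bilinear b -> forall x y, b x (- y) = - b x y.
Proof.
by move=> bb x y; rewrite -[- y]sub0r -(subrr y) 2!(bilinearBr bb) subrr sub0r.
Qed.

Lemma trilinearB1 t : is_trilinear t ->
  forall x x' y z, t (x - x') y z = t x y z - t x' y z.
Proof. by case=> + _ x x' y z => /(_ y z) /zmod_morphism_linear. Qed.

Lemma trilinearN1 t : is_trilinear t ->
  forall x y z, t (- x) y z = - t x y z.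
Proof.
move=> tt x y z.
by rewrite -[- x]sub0r -(subrr x) 2!(trilinearB1 tt) subrr sub0r.
Qed.

Lemma trilinearB2 t : is_trilinear t ->
  forall x y y' z, t x (y - y') z = t x y z - t x y' z.
Proof. by case=> _ + x => /(_ x) /bilinearBl. Qed.

(** Polarization at [x - y]: the diagonal terms vanish and [- (f x y + f y x)] remains. Serves the
    binary bracket and, with the last argument fixed, the ternary one. *)
Lemma alternating_skew (V : zmodType) (f : V -> V -> V) :
    (forall x x' y, f (x - x') y = f x y - f x' y) ->
    (forall x y y', f x (y - y') = f x y - f x y') ->
    (forall x, f x x = 0) ->
  forall x y, f x y = - f y x.
Proof.
move=> fBl fBr fxx x y; have := fxx (x - y).
rewrite fBl !fBr !fxx sub0r subr0 -opprD => /eqP.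
by rewrite oppr_eq0 addr_eq0 => /eqP.
Qed.

Lemma bilinear_precomp b (R : {linear L -> L}) :
  is_bilinear b -> is_bilinear (fun x y => b (R x) y).
Proof.
case=> bl br; split=> [y a u v|x a u v] /=; last exact: br.
by rewrite linearP; apply: bl.
Qed.

Lemma trilinear_precomp t (R : {linear L -> L}) :
  is_trilinear t -> is_trilinear (fun x y z => t x (R y) (R z)).
Proof.
case=> tl tr; split=> [y z|x]; first exact: tl.
case: (tr x) => tm tr'; split=> [z a u v|y a u v] /=.
  by rewrite linearP; apply: tm.
by rewrite linearP; apply: tr'.
Qed.

End Multilinear.

Section LYTheory.
Variables (K : fieldType) (L : lmodType K).
Variables (b : L -> L -> L) (t : L -> L -> L -> L).
Hypothesis hL : is_LieYamaguti b t.

Lemma LY_skew2 x y : b x y = - b y x.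
Proof.
have bb := LY_bilinear hL.
by apply: alternating_skew (LY_alt2 hL) _ _;
  [apply: bilinearBl|apply: bilinearBr].
Qed.

Lemma LY_skew3 x y z : t x y z = - t y x z.
Proof.
have tt := LY_trilinear hL.
apply: (@alternating_skew _ (fun x y => t x y z)) => [*|*|u].
- exact: trilinearB1.
- exact: trilinearB2.
- exact: LY_alt3 hL u z.
Qed.

Variable R : {linear L -> L}.
Hypothesis hR : is_RotaBaxter b t R.

Local Notation s := (fun x y => b (R x) y).
Local Notation p := (fun x y z => t x (R y) (R z)).

(** By antisymmetry the commutator is exactly the argument of [R] in the binary Rota-Baxter
    identity. *)
Lemma RB_commutator x y : R (commutator s x y) = b (R x) (R y).
Proof. by rewrite hR.1 /commutator (LY_skew2 x) addrC. Qed.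

Lemma RB_Dbracket x y z : Dbracket s p x y z = t (R x) (R y) z.
Proof.
have bb := LY_bilinear hL.
(* The terms of the two associators with nested [R] differ by [b (b (R x) (R y)) z], the leading
   term of [LY1] at [R x], [R y], [z]. *)
have Ryx : b (R (b (R y) x)) z = b (R (b (R x) y)) z - b (b (R x) (R y)) z.
  by rewrite -RB_commutator /commutator linearB bilinearBl // subKr.
have zRxRy : b (b z (R x)) (R y) = b (R y) (b (R x) z).
  by rewrite LY_skew2 (LY_skew2 z) bilinearNr // opprK.
have := LY1 hL (R x) (R y) z.
rewrite zRxRy (LY_skew2 _ (R x)) (LY_skew3 (R y) z) => jacobi.
(* Subtracting the vanishing sum [jacobi] from the right-hand side leaves the same five terms as on
   the left, once one opposite pair is cancelled on each side. *)
rewrite -[RHS]subr0 -jacobi /Dbracket /associator Ryx !opprD !opprK !addrA.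
rewrite [LHS](ACl ((3*6)*(1*2*4*5*7))) [RHS](ACl ((1*5)*(6*7*2*4*3))) /=.
by rewrite !subrr.
Qed.

(** Since [t (R x) y (R z) = - t y (R x) (R z)], the ternary Rota-Baxter identity takes the form
    [{x,y,z}_D + {x,y,z} - {y,x,z}], the combination found in the last three axioms. *)
Lemma RB_ternary x y z :
  R (t (R x) (R y) z + t x (R y) (R z) - t y (R x) (R z)) = t (R x) (R y) (R z).
Proof. by rewrite hR.2 (LY_skew3 (R x) y) addrAC. Qed.

End LYTheory.

Section Pair.
Variables (K : fieldType) (L : lmodType K).
Variables (b : L -> L -> L) (t : L -> L -> L -> L).
Variables (b' : L -> L -> L) (t' : L -> L -> L -> L).
Hypotheses (hL : is_LieYamaguti b t) (hL' : is_LieYamaguti b' t').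
Variable R : {linear L -> L}.
Hypotheses (hR : is_RotaBaxter b t R) (hR' : is_RotaBaxter b' t' R).

Local Notation s := (fun x y => b (R x) y).
Local Notation p := (fun x y z => t x (R y) (R z)).
Local Notation s' := (fun x y => b' (R x) y).
Local Notation p' := (fun x y z => t' x (R y) (R z)).

Lemma PLY1_pairE x y z w :
  p' z (commutator s x y) w - p' (s y z) x w + p' (s x z) y w
  = - (t' (b (R x) (R y)) z (R w) + t' (b (R y) z) (R x) (R w)
       + t' (b z (R x)) (R y) (R w)).
Proof.
have tt := LY_trilinear hL'.
rewrite /= (RB_commutator hL hR) (LY_skew3 hL' z) (LY_skew2 hL z).
by rewrite trilinearN1 // !opprD !opprK.
Qed.

Lemma PLY2_pairE x y z w :
  p' x y (commutator s z w) = t' x (R y) (b (R z) (R w)).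
Proof. by rewrite /= (RB_commutator hL hR). Qed.

Lemma PLY3_pairE x y z w v :
  p' (p x y z) w v - p' (p x y w) z v - p' x y (Dbracket s p z w v)
  - p' x y (p z w v) + p' x y (p w z v) + Dbracket s' p' z w (p x y v)
  = t' (t x (R y) (R z)) (R w) (R v) + t' (R z) (t x (R y) (R w)) (R v)
    + t' (R z) (R w) (t x (R y) (R v)) - t' x (R y) (t (R z) (R w) (R v)).
Proof.
have tt := LY_trilinear hL'.
have /(trilinear_precomp R)[_ /(_ x)[_ /(_ y)/linear_addsub /= ptD]] := tt.
(* Read backwards, [RB_ternary] opens [t (R z) (R w) (R v)] on the right into the three terms inside
   [p' x y] on the left. *)
rewrite !RB_Dbracket // -(RB_ternary hL hR z) ptD.
rewrite (LY_skew3 hL' (R z) (t _ _ _)).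
by rewrite !opprD !opprK !addrA [RHS](ACl (1*2*4*5*6*3)).
Qed.

Lemma PLY4_pairEl x y z w v :
  p' z (Dbracket s p x y w) v + p' z (p x y w) v - p' z (p y x w) v
  + p' z w (Dbracket s p x y v) + p' z w (p x y v) - p' z w (p y x v)
  = t' z (t (R x) (R y) (R w)) (R v) + t' z (R w) (t (R x) (R y) (R v)).
Proof.
have [_ /(_ z)[/(_ v)/linear_addsub/= pt2 /(_ w)/linear_addsub/= pt3]] :=
  trilinear_precomp R (LY_trilinear hL').
by rewrite !RB_Dbracket // -!(RB_ternary hL hR) pt2 pt3 !addrA.
Qed.

Lemma PLY4_pairEr x y z w v :
  Dbracket s' p' x y (p z w v) - p' (Dbracket s p x y z) w v
  = t' (R x) (R y) (t z (R w) (R v)) - t' (t (R x) (R y) z) (R w) (R v).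
Proof. by rewrite !RB_Dbracket. Qed.

Lemma PLY5_pairEl x y z w :
  s' (Dbracket s p x y z) w + s' (p x y z) w - s' (p y x z) w
  = b' (t (R x) (R y) (R z)) w.
Proof.
have [/(_ w)/linear_addsub/= bl _] := bilinear_precomp R (LY_bilinear hL').
by rewrite RB_Dbracket // -(RB_ternary hL hR) bl.
Qed.

Lemma PLY5_pairEr x y z w :
  Dbracket s' p' x y (s z w) - s z (Dbracket s' p' x y w)
  = t' (R x) (R y) (b (R z) w) - b (R z) (t' (R x) (R y) w).
Proof. by rewrite !RB_Dbracket. Qed.

End Pair.

Lemma RB_preLieYamaguti (K : fieldType) (L : lmodType K)
    (b : L -> L -> L) (t : L -> L -> L -> L) (R : {linear L -> L}) :
    is_LieYamaguti b t -> is_RotaBaxter b t R ->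
  is_preLieYamaguti (fun x y => b (R x) y) (fun x y z => t x (R y) (R z)).
Proof.
move=> hL hR; split.
- exact: bilinear_precomp (LY_bilinear hL).
- exact: trilinear_precomp (LY_trilinear hL).
- by move=> x y z w; rewrite (PLY1_pairE hL hL hR) (LY2 hL) oppr0.
- move=> x y z w; rewrite (PLY2_pairE _ hL hR) (LY3 hL) addrC.
  by rewrite (LY_skew2 hL _ (R w)).
- by move=> x y z w v; rewrite (PLY3_pairE hL hL hR hR) (LY4 hL x) subrr.
- move=> x y z w v; rewrite (PLY4_pairEl hL hL hR).
  rewrite (PLY4_pairEr hL hL hR hR) (LY4 hL (R x)).
  by rewrite [RHS](ACl (1*4*2*3)) /= subrr add0r.
- move=> x y z w; rewrite (PLY5_pairEl hL hL hR) (PLY5_pairEr _ hL hR) (LY3 hL).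
  by rewrite addrK.
Qed.

Theorem theorem6p3 (K : fieldType) (charK0 : [pchar K] =i pred0)
    (L : lmodType K)
    (b1 : L -> L -> L) (t1 : L -> L -> L -> L)
    (b2 : L -> L -> L) (t2 : L -> L -> L -> L)
    (hL : is_compatible_LieYamaguti b1 t1 b2 t2)
    (R : {linear L -> L})
    (hR : is_compatible_RotaBaxter b1 t1 b2 t2 R) :
  is_compatible_preLieYamaguti
    (fun x y => b1 (R x) y) (fun x y z => t1 x (R y) (R z))
    (fun x y => b2 (R x) y) (fun x y z => t2 x (R y) (R z)).
Proof.
have [hL1 hL2 _ cy2 cy3 cy4] := hL; have [hR1 hR2] := hR.
split.
- exact: RB_preLieYamaguti.
- exact: RB_preLieYamaguti.
- move=> x y z w; rewrite /sum_ij.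
  rewrite (PLY1_pairE hL1 hL2 hR1) (PLY1_pairE hL2 hL1 hR2).
  by rewrite -opprD !addrA cy2 oppr0.
- move=> x y z w; rewrite (PLY2_pairE _ hL1 hR1) (PLY2_pairE _ hL2 hR2).
  (* [CY4] at [x], [R y], [R z], [R w]; antisymmetry then brings [R w] to the first slot, as in the
     products by [w]. *)
  rewrite addrC cy4 (LY_skew2 hL1 _ (R w)) (LY_skew2 hL2 _ (R w)).
  by rewrite [LHS](ACl (4*2*3*1)).
- move=> x y z w v; rewrite /sum_ij.
  rewrite (PLY3_pairE hL1 hL2 hR1 hR2) (PLY3_pairE hL2 hL1 hR2 hR1).
  (* With the subtracted terms of both halves collected, the claim is [CY3] at [x], [R y], [R z],
     [R w], [R v]. *)
  rewrite addrACA -opprD; apply/eqP; rewrite subr_eq0; apply/eqP.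
  by rewrite cy3 !addrA.
- move=> x y z w v; rewrite /sum_ij.
  rewrite (PLY4_pairEl hL1 hL2 hR1) (PLY4_pairEl hL2 hL1 hR2).
  rewrite (PLY4_pairEr hL1 hL2 hR1 hR2) (PLY4_pairEr hL2 hL1 hR2 hR1).
  (* [CY3] at [R x], [R y], [z], [R w], [R v]: of its six terms, the two with [z] in the inner
     bracket are those subtracted, and the other four form the left-hand side. *)
  rewrite [RHS]addrACA cy3 -opprD.
  apply/eqP; rewrite eq_sym subr_eq; apply/eqP.
  by rewrite !addrA [RHS](ACl (5*1*2*6*3*4)).
- move=> x y z w; rewrite /sum_ij.
  rewrite (PLY5_pairEl hL1 hL2 hR1) (PLY5_pairEl hL2 hL1 hR2).
  rewrite (PLY5_pairEr _ hL2 hR2) (PLY5_pairEr _ hL1 hR1).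
  (* Likewise for [CY4] at [R x], [R y], [R z], [w]: the two terms with [w] in the inner bracket are
     those subtracted. *)
  rewrite [RHS]addrACA cy4 -opprD.
  apply/eqP; rewrite eq_sym subr_eq; apply/eqP.
  by rewrite !addrA [RHS](ACl (1*4*2*3)).
Qed.
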